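(* Let $M^n=\overline M^p\times\widetilde M^{n-p}$ be a product manifold and let $\Pi,\Phi$ be $1$-forms on $M$. Then $M$ is a $WGK_n$ with $(\Pi,\Phi)$ if and only if the following conditions hold simultaneously (at every point of $U$): 1.(i) $\overline\nabla\,\overline R=\overline\Pi\otimes\overline R+\overline\Phi\otimes\overline S\wedge\overline S$, (ii) $\widetilde\Pi\otimes\overline R+\widetilde\Phi\otimes\overline S\wedge\overline S=0$; 2.(i) $\overline\Pi\otimes\widetilde R+\overline\Phi\otimes\widetilde S\wedge\widetilde S=0$, (ii) $\widetilde\nabla\widetilde R=\widetilde\Pi\otimes\widetilde R+\widetilde\Phi\otimes\widetilde S\wedge\widetilde S$; 3.(i) $\overline\Phi\otimes\overline S\otimes\widetilde S=0$, (ii) $\widetilde\Phi\otimes\overline S\otimes\widetilde S=0$.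
   Context: Curvature conventions. For a semi-Riemannian metric $g$ with Levi-Civita connection $\nabla$: $R_{ijkl}=g\big((\nabla_{\partial_j}\nabla_{\partial_i}-\nabla_{\partial_i}\nabla_{\partial_j})\partial_k,\partial_l\big)$ is the $(0,4)$ Riemann-Christoffel tensor and $S_{jk}=g^{il}R_{ijkl}$ the Ricci tensor. For symmetric $(0,2)$-tensors $A,E$, the Kulkarni-Nomizu product is $(A\wedge E)_{ijkl}=A_{il}E_{jk}+A_{jk}E_{il}-A_{ik}E_{jl}-A_{jl}E_{ik}$. In $\nabla R=\Pi\otimes R+\dots$ the $1$-form index is the differentiation index: $R_{ijkl,m}=\Pi_mR_{ijkl}+\dots$. Product. $(\overline M,\overline g)$ and $(\widetilde M,\widetilde g)$ are semi-Riemannian manifolds of dimensions $p$ and $n-p$ ($1\le p<n$, $n\ge3$) and $M=\overline M\times\widetilde M$ carries the product metric $g=\overline g+\widetilde g$; $M$ is assumed non-flat. Overlined (resp. tilded) tensors $\overline R,\overline S,\overline\nabla$ (resp. $\widetilde R,\widetilde S,\widetilde\nabla$) are those of $\overline g$ (resp. $\widetilde g$) pulled back to $M$; tensor products of base and fibre tensors are compared componentwise, irrespective of the order of factors. For a $1$-form $\Pi$ on $M$, $\overline\Pi$ and $\widetilde\Pi$ denote its parts with components along $\overline M$ and $\widetilde M$ respectively (components are functions on $M$), and similarly for $\Phi$. Definition. Let $U=\{x\in M:\nabla R\ne\xi\otimes R\text{ at }x\text{ for every }1\text{-form }\xi\}$. $M$ is a $WGK_n$ (weakly generalized recurrent) with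 $(\Pi,\Phi)$ if $\nabla R=\Pi\otimes R+\Phi\otimes S\wedge S$ holds on $U$. *)

(* Defs.v *)
From HB Require Import structures.
From mathcomp Require Import all_boot all_order all_algebra.
From mathcomp Require Import all_classical all_reals all_analysis.

Set Implicit Arguments.
Unset Strict Implicit.
Unset Printing Implicit Defensive.

Import Order.TTheory GRing.Theory Num.Theory.
Import numFieldNormedType.Exports.

Local Open Scope classical_set_scope.
Local Open Scope ring_scope.

Section Smooth.
Context {R : realType} {n : nat}.

Definition partial (i : 'I_n) (f : 'rV[R]_n -> R) : 'rV[R]_n -> R :=
  'D_(delta_mx 0 i) f.

(* C^oo on A, for an open set A: all iterated partial derivatives exist and are
   continuous at the points of A. *)
Definition smooth_on (A : set 'rV[R]_n) (f : 'rV[R]_n -> R) : Prop :=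
  forall (s : seq 'I_n) (u : 'rV[R]_n), A u ->
    {for u, continuous (foldr partial f s)} /\
    forall i : 'I_n, derivable (foldr partial f s) u (delta_mx 0 i).

End Smooth.

(* A smooth manifold of dimension n, given by a smooth atlas (not necessarily
   a maximal one).  Of the coordinate map [loc c] only the values on the open
   set [dom c] matter; [par c] is its inverse there. *)
Record manifold (R : realType) (n : nat) := Manifold {
  pts :> topologicalType;
  chart : Type;
  dom : chart -> set pts;
  loc : chart -> pts -> 'rV[R]_n;
  par : chart -> 'rV[R]_n -> pts;
  pts_hausdorff : hausdorff_space pts;
  pts_second_countable : @second_countable pts;
  dom_cover : forall x : pts, exists c, dom c x;
  dom_open : forall c, open (dom c);
  loc_open : forall c, open (loc c @` dom c);
  locK : forall c x, dom c x -> par c (loc c x) = x;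
  loc_continuous : forall c x, dom c x -> {for x, continuous (loc c)};
  par_continuous : forall c x, dom c x -> {for loc c x, continuous (par c)};
  transition_smooth : forall c d (i : 'I_n),
    smooth_on (loc c @` (dom c `&` dom d)) (fun u => loc d (par c u) 0 i)
}.

Arguments chart {R n} _.
Arguments dom {R n m} _ _.
Arguments loc {R n m} _ _.
Arguments par {R n m} _ _.
Arguments transition_smooth {R n} _ _ _ _.

Section Tensors.
Context {R : realType} {n : nat} {M : manifold R n}.

Definition dpartial (c : chart M) (i : 'I_n) (f : M -> R) (x : M) : R :=
  partial i (f \o par c) (loc c x).

Definition jac (c d : chart M) (x : M) : 'M[R]_n :=
  \matrix_(k, i) dpartial c i (fun y => loc d y 0 k) x.

(* g is congruent to a diagonal matrix with nu entries -1 and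
   n - nu entries 1, i.e. g is nondegenerate of index nu. *)
Definition has_index (nu : nat) (g : 'M[R]_n) : Prop :=
  exists (P : 'M[R]_n) (s : 'I_n -> bool),
    [/\ P \in unitmx, P *m g *m P^T = diag_mx (\row_i (-1) ^+ s i)
      & #|s| = nu].

End Tensors.

Arguments has_index {R n} _ _.

Record metric (R : realType) (n : nat) (M : manifold R n) := Metric {
  metric_val :> chart M -> M -> 'M[R]_n;
  metric_sym : forall c x, dom c x -> (metric_val c x)^T = metric_val c x;
  metric_nondeg : forall c x, dom c x -> metric_val c x \in unitmx;
  metric_index : exists nu, forall c x, dom c x -> has_index nu (metric_val c x);
  metric_change : forall c d x, dom c x -> dom d x ->
    metric_val c x = (jac c d x)^T *m metric_val d x *m jac c d x;
  metric_smooth : forall c i j,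
    smooth_on (loc c @` dom c) (fun u => metric_val c (par c u) i j)
}.

Arguments metric_smooth {R n M} _ _ _ _.

Record one_form (R : realType) (n : nat) (M : manifold R n) := OneForm {
  form_val :> chart M -> M -> 'rV[R]_n;
  form_change : forall c d x, dom c x -> dom d x ->
    form_val c x = form_val d x *m jac c d x;
  form_smooth : forall c i,
    smooth_on (loc c @` dom c) (fun u => form_val c (par c u) 0 i)
}.

Arguments form_smooth {R n M} _ _ _.

Definition KN (R : realType) (n : nat) (A E : 'I_n -> 'I_n -> R)
    (i j k l : 'I_n) : R :=
  A i l * E j k + A j k * E i l - A i k * E j l - A j l * E i k.

Section Curvature.
Context {R : realType} {n : nat} {M : manifold R n} (g : metric M).
Implicit Types (c : chart M) (x : M) (i j k l m : 'I_n).

(* [christoffel c k i j] is Gamma^k_ij, for the Levi-Civita connection of g. *)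
Definition christoffel c k i j x : R :=
  2^-1 * \sum_l invmx (g c x) k l *
    (dpartial c i (fun y => g c y j l) x + dpartial c j (fun y => g c y i l) x
     - dpartial c l (fun y => g c y i j) x).

(* The components of nabla_(d_i) V, for a vector field V on the domain of c
   given by its components. *)
Definition nabla_vec c i (V : 'I_n -> M -> R) : 'I_n -> M -> R := fun m x =>
  dpartial c i (V m) x + \sum_a christoffel c m i a x * V a x.

Definition coord_field k : 'I_n -> M -> R := fun m _ => (m == k)%:R.

(* R_ijkl = g((nabla_j nabla_i - nabla_i nabla_j) d_k, d_l) *)
Definition riem c x i j k l : R :=
  \sum_m (nabla_vec c j (nabla_vec c i (coord_field k)) m x
          - nabla_vec c i (nabla_vec c j (coord_field k)) m x) * g c x m l.

Definition ricci c x j k : R :=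
  \sum_i \sum_l invmx (g c x) i l * riem c x i j k l.

(* [nabla_riem c x m i j k l] is R_ijkl,m: the differentiation index m comes
   first, as in the tensor product of a 1-form with a (0,4)-tensor. *)
Definition nabla_riem c x m i j k l : R :=
  dpartial c m (fun y => riem c y i j k l) x
  - \sum_a (christoffel c a m i x * riem c x a j k l
            + christoffel c a m j x * riem c x i a k l
            + christoffel c a m k x * riem c x i j a l
            + christoffel c a m l x * riem c x i j k a).

Definition flat : Prop :=
  forall c x, dom c x -> forall i j k l, riem c x i j k l = 0.

Definition recurrent_at (xi : one_form M) x : Prop :=
  forall c, dom c x -> forall m i j k l,
    nabla_riem c x m i j k l = xi c x 0 m * riem c x i j k l.

Definition nonrecurrent_set : set M :=
  [set x | forall xi : one_form M, ~ recurrent_at xi x].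

Definition WGK (Pi Phi : one_form M) : Prop :=
  forall x, nonrecurrent_set x -> forall c, dom c x -> forall m i j k l,
    nabla_riem c x m i j k l =
      Pi c x 0 m * riem c x i j k l
      + Phi c x 0 m * KN (ricci c x) (ricci c x) i j k l.

End Curvature.

Section SmoothProduct.
Context {R : realType} {p q : nat}.
Implicit Types (f : 'rV[R]_p -> R) (h : 'rV[R]_q -> R).

Lemma partial_cst n (a : R) (i : 'I_n) : partial i (cst a) = cst 0.
Proof. by apply/funext => u; rewrite /partial derive_cst. Qed.

Lemma smooth_cst n (A : set 'rV[R]_n) (a : R) : smooth_on A (cst a).
Proof.
move=> s u _.
have [b ->] : exists b : R, foldr partial (cst a) s = cst b.
  elim: s => [|i s [b IH]] /=; first by exists a.
  by exists 0; rewrite IH partial_cst.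
by split; [exact: cst_continuous | move=> i; exact: derivable_cst].
Qed.

Lemma lsub_delta_l (i : 'I_p) :
  lsubmx (delta_mx 0 (lshift q i) : 'rV[R]_(p + q)) = delta_mx 0 i.
Proof. by apply/rowP => j; rewrite !mxE (inj_eq (@lshift_inj _ _)). Qed.

Lemma lsub_delta_r (i : 'I_q) :
  lsubmx (delta_mx 0 (rshift p i) : 'rV[R]_(p + q)) = 0.
Proof. by apply/rowP => j; rewrite !mxE eq_lrshift andbF. Qed.

Lemma rsub_delta_l (i : 'I_p) :
  rsubmx (delta_mx 0 (lshift q i) : 'rV[R]_(p + q)) = 0.
Proof. by apply/rowP => j; rewrite !mxE eq_rlshift andbF. Qed.

Lemma rsub_delta_r (i : 'I_q) :
  rsubmx (delta_mx 0 (rshift p i) : 'rV[R]_(p + q)) = delta_mx 0 i.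
Proof. by apply/rowP => j; rewrite !mxE (inj_eq (@rshift_inj _ _)). Qed.

Lemma quotient_lsub f (u v : 'rV[R]_(p + q)) :
  (fun t : R => t^-1 *: (((f \o lsubmx) \o shift u) (t *: v) - (f \o lsubmx) u))
  = (fun t => t^-1 *: ((f \o shift (lsubmx u)) (t *: lsubmx v) - f (lsubmx u))).
Proof.
apply/funext => t /=.
by have -> : lsubmx (t *: v + u) = t *: lsubmx v + lsubmx u
  by apply/rowP => j; rewrite !mxE.
Qed.

Lemma quotient_rsub h (u v : 'rV[R]_(p + q)) :
  (fun t : R => t^-1 *: (((h \o rsubmx) \o shift u) (t *: v) - (h \o rsubmx) u))
  = (fun t => t^-1 *: ((h \o shift (rsubmx u)) (t *: rsubmx v) - h (rsubmx u))).
Proof.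
apply/funext => t /=.
by have -> : rsubmx (t *: v + u) = t *: rsubmx v + rsubmx u
  by apply/rowP => j; rewrite !mxE.
Qed.

Lemma derive_lsub f (u v : 'rV[R]_(p + q)) :
  'D_v (f \o lsubmx) u = 'D_(lsubmx v) f (lsubmx u).
Proof. by rewrite /derive quotient_lsub. Qed.

Lemma derive_rsub h (u v : 'rV[R]_(p + q)) :
  'D_v (h \o rsubmx) u = 'D_(rsubmx v) h (rsubmx u).
Proof. by rewrite /derive quotient_rsub. Qed.

Lemma derivable_lsub f (u v : 'rV[R]_(p + q)) :
  derivable (f \o lsubmx) u v <-> derivable f (lsubmx u) (lsubmx v).
Proof. by rewrite /derivable quotient_lsub. Qed.

Lemma derivable_rsub h (u v : 'rV[R]_(p + q)) :
  derivable (h \o rsubmx) u v <-> derivable h (rsubmx u) (rsubmx v).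
Proof. by rewrite /derivable quotient_rsub. Qed.

Lemma partial_lsub f (i : 'I_(p + q)) :
  partial i (f \o lsubmx) =
    if fintype.split i is inl a then partial a f \o lsubmx else cst 0.
Proof.
apply/funext => u; rewrite /partial derive_lsub.
by case: split_ordP => a ->; rewrite ?lsub_delta_l // lsub_delta_r derive0.
Qed.

Lemma partial_rsub h (i : 'I_(p + q)) :
  partial i (h \o rsubmx) =
    if fintype.split i is inr a then partial a h \o rsubmx else cst 0.
Proof.
apply/funext => u; rewrite /partial derive_rsub.
by case: split_ordP => a ->; rewrite ?rsub_delta_r // rsub_delta_l derive0.
Qed.

Lemma smooth_lsub A f :
  smooth_on A f -> smooth_on [set u : 'rV[R]_(p + q) | A (lsubmx u)] (f \o lsubmx).
Proof.
move=> Af s u Au.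
have [[b ->]|[t ->]] : (exists b : R, foldr partial (f \o lsubmx) s = cst b) \/
    exists t, foldr partial (f \o lsubmx) s = foldr partial f t \o lsubmx.
- elim: s => [|i s [[b IH]|[t IH]]] /=; first by right; exists [::].
    by left; exists 0; rewrite IH partial_cst.
  rewrite IH partial_lsub; case: fintype.split => a; last by left; exists 0.
  by right; exists (a :: t).
- by split; [exact: cst_continuous | move=> i; exact: derivable_cst].
have [ct dt] := Af t _ Au; split.
  by apply: continuous_comp; [exact: continuous_lsubmx | exact: ct].
move=> i; apply/derivable_lsub; case: (split_ordP i) => a ->.
  by rewrite lsub_delta_l.
by rewrite lsub_delta_r; exact: derivable0.
Qed.

Lemma smooth_rsub A h :
  smooth_on A h -> smooth_on [set u : 'rV[R]_(p + q) | A (rsubmx u)] (h \o rsubmx).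
Proof.
move=> Ah s u Au.
have [[b ->]|[t ->]] : (exists b : R, foldr partial (h \o rsubmx) s = cst b) \/
    exists t, foldr partial (h \o rsubmx) s = foldr partial h t \o rsubmx.
- elim: s => [|i s [[b IH]|[t IH]]] /=; first by right; exists [::].
    by left; exists 0; rewrite IH partial_cst.
  rewrite IH partial_rsub; case: fintype.split => a; first by left; exists 0.
  by right; exists (a :: t).
- by split; [exact: cst_continuous | move=> i; exact: derivable_cst].
have [ct dt] := Ah t _ Au; split.
  by apply: continuous_comp; [exact: continuous_rsubmx | exact: ct].
move=> i; apply/derivable_rsub; case: (split_ordP i) => a ->.
  by rewrite rsub_delta_l; exact: derivable0.
by rewrite rsub_delta_r.
Qed.

Lemma smooth_sub n (A B : set 'rV[R]_n) (f : 'rV[R]_n -> R) :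
  A `<=` B -> smooth_on B f -> smooth_on A f.
Proof. by move=> AB Bf s u /AB; exact: Bf. Qed.

End SmoothProduct.

Section ProductManifold.
Context {R : realType} {p q : nat} (Mb : manifold R p) (Mt : manifold R q).

Let chartP := (chart Mb * chart Mt)%type.
Let domP (c : chartP) : set (Mb * Mt)%type := dom c.1 `*` dom c.2.
Let locP (c : chartP) (x : (Mb * Mt)%type) : 'rV[R]_(p + q) :=
  row_mx (loc c.1 x.1) (loc c.2 x.2).
Let parP (c : chartP) (u : 'rV[R]_(p + q)) : (Mb * Mt)%type :=
  (par c.1 (lsubmx u), par c.2 (rsubmx u)).

Fact prod_hausdorff : hausdorff_space (Mb * Mt)%type.
Proof.
move=> [x1 x2] [y1 y2] cl; congr (_, _).
  apply: pts_hausdorff => A B xA yB.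
  have [||[z1 z2] [/= zA zB]] := cl (A `*` setT) (B `*` setT).
  - by exists (A, setT) => //; split => //; exact: filterT.
  - by exists (B, setT) => //; split => //; exact: filterT.
  by exists z1; split; [case: zA | case: zB].
apply: pts_hausdorff => A B xA yB.
have [||[z1 z2] [/= zA zB]] := cl (setT `*` A) (setT `*` B).
- by exists (setT, A) => //; split => //; exact: filterT.
- by exists (setT, B) => //; split => //; exact: filterT.
by exists z2; split; [case: zA | case: zB].
Qed.

Lemma open_setX (T U : topologicalType) (A : set T) (B : set U) :
  open A -> open B -> open (A `*` B).
Proof.
rewrite !openE => oA oB [x y] [/= /oA Ax /oB By].
by exists (A, B).
Qed.

Fact prod_second_countable : @second_countable (Mb * Mt)%type.
Proof.
have [B1 cB1 [oB1 nB1]] := pts_second_countable Mb.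
have [B2 cB2 [oB2 nB2]] := pts_second_countable Mt.
exists [set A.1 `*` A.2 | A in B1 `*` B2].
  by apply: sub_countable (card_image_le _ _) (countableX cB1 cB2).
split=> [_ [[A1 A2] [/= A1B A2B] <-]|[x1 x2] A].
  by apply: open_setX; [exact: oB1 | exact: oB2].
case=> -[U1 U2] [/= /nB1[V1 [V1B V1x] V1U] /nB2[V2 [V2B V2x] V2U]] UA.
exists (V1 `*` V2).
  by split => //; exists (V1, V2).
by move=> [y1 y2] [/= /V1U ? /V2U ?]; apply: UA.
Qed.

Fact prod_dom_cover (x : (Mb * Mt)%type) : exists c, domP c x.
Proof.
have [c xc] := dom_cover x.1; have [d xd] := dom_cover x.2.
by exists (c, d).
Qed.

Fact prod_dom_open c : open (domP c).
Proof. by apply: open_setX; exact: dom_open. Qed.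

Lemma prod_loc_image (A : set Mb) (B : set Mt) (c : chartP) :
  [set locP c x | x in A `*` B] =
  [set u | (loc c.1 @` A) (lsubmx u)] `&` [set u | (loc c.2 @` B) (rsubmx u)].
Proof.
apply/seteqP; split=> u.
  by case=> -[x y] [/= Ax By] <-; rewrite /locP row_mxKl row_mxKr;
    split; [exists x | exists y].
case=> -[x Ax xu] [y By yu]; exists (x, y) => //.
by rewrite /locP /= xu yu hsubmxK.
Qed.

Fact prod_loc_open c : open (locP c @` domP c).
Proof.
rewrite prod_loc_image; apply: openI.
  apply: (@open_comp _ _ lsubmx (loc c.1 @` dom c.1)); last exact: loc_open.
  by move=> u _; exact: continuous_lsubmx.
apply: (@open_comp _ _ rsubmx (loc c.2 @` dom c.2)); last exact: loc_open.
by move=> u _; exact: continuous_rsubmx.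
Qed.

Fact prod_locK c x : domP c x -> parP c (locP c x) = x.
Proof.
case: x => x y [/= cx cy].
by rewrite /parP /locP row_mxKl row_mxKr !locK.
Qed.

Lemma pair_continuous (S T U : topologicalType) (f : S -> T)
    (h : S -> U) (x : S) :
  {for x, continuous f} -> {for x, continuous h} ->
  {for x, continuous (fun y => (f y, h y))}.
Proof.
move=> cf ch A [[B C] [/= /cf fB /ch hC] BCA].
have BC : nbhs x ((f @^-1` B) `&` (h @^-1` C)) by exact: filterI.
have sub : (f @^-1` B) `&` (h @^-1` C) `<=` (fun y => (f y, h y)) @^-1` A.
  by move=> y [/= By Cy]; exact: (BCA (_, _)).
exact: (filterS sub BC).
Qed.

Lemma row_mx_continuous :
  continuous (fun u : ('rV[R]_p * 'rV[R]_q)%type => row_mx u.1 u.2).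
Proof.
move=> [u v] A /nbhs_ballP[e /= e0 eA].
apply/nbhs_ballP; exists e => //= -[u' v'] [/= [_ bu] [_ bv]].
apply: eA; split => // i j /=; rewrite !mxE.
by case: fintype.split => a; [exact: bu | exact: bv].
Qed.

Fact prod_loc_continuous c x : domP c x -> {for x, continuous (locP c)}.
Proof.
case: x => x y [/= cx cy].
apply: (@continuous_comp _ _ _ (fun z : (Mb * Mt)%type => (loc c.1 z.1, loc c.2 z.2))
  (fun u : ('rV[R]_p * 'rV[R]_q)%type => row_mx u.1 u.2)); last first.
  exact: row_mx_continuous.
apply: pair_continuous.
  by apply: (@continuous_comp _ _ _ fst (loc c.1));
    [exact: cvg_fst | exact: loc_continuous].
by apply: (@continuous_comp _ _ _ snd (loc c.2));
  [exact: cvg_snd | exact: loc_continuous].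
Qed.

Fact prod_par_continuous c x : domP c x ->
  {for locP c x, continuous (parP c)}.
Proof.
case: x => x y [/= cx cy].
apply: pair_continuous.
  apply: (@continuous_comp _ _ _ lsubmx (par c.1)).
    exact: continuous_lsubmx.
  by rewrite /locP row_mxKl; exact: par_continuous.
apply: (@continuous_comp _ _ _ rsubmx (par c.2)).
  exact: continuous_rsubmx.
by rewrite /locP row_mxKr; exact: par_continuous.
Qed.

Fact prod_transition_smooth c d (i : 'I_(p + q)) :
  smooth_on (locP c @` (domP c `&` domP d)) (fun u => locP d (parP c u) 0 i).
Proof.
have -> : domP c `&` domP d =
    (dom c.1 `&` dom d.1) `*` (dom c.2 `&` dom d.2).
  by apply/seteqP; split=> -[x y] [] [/= ? ?] [/= ? ?]; do 2!split.
rewrite prod_loc_image; case: (split_ordP i) => a ->.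
  rewrite (_ : (fun _ => _) = (fun u => loc d.1 (par c.1 u) 0 a) \o lsubmx).
    refine (smooth_sub _ (smooth_lsub (transition_smooth _ c.1 d.1 a))).
    exact: subIsetl.
  by apply/funext => u; rewrite /locP /= row_mxEl.
rewrite (_ : (fun _ => _) = (fun u => loc d.2 (par c.2 u) 0 a) \o rsubmx).
  refine (smooth_sub _ (smooth_rsub (transition_smooth _ c.2 d.2 a))).
  exact: subIsetr.
by apply/funext => u; rewrite /locP /= row_mxEr.
Qed.

Definition prod_manifold : manifold R (p + q) :=
  Manifold prod_hausdorff prod_second_countable prod_dom_cover prod_dom_open
    prod_loc_open prod_locK prod_loc_continuous prod_par_continuous
    prod_transition_smooth.

End ProductManifold.

Section ProductMetric.
Context {R : realType} {p q : nat} {Mb : manifold R p} {Mt : manifold R q}.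
Variables (gb : metric Mb) (gt : metric Mt).
Let M := prod_manifold Mb Mt.

Let gP (c : chart M) (x : M) : 'M[R]_(p + q) :=
  block_mx (gb c.1 x.1) 0 0 (gt c.2 x.2).

Lemma dpartial_base (c : chart M) (i : 'I_(p + q)) (f : Mb -> R) (x : M) :
  dpartial c i (fun y : M => f y.1) x =
    if fintype.split i is inl a then dpartial c.1 a f x.1 else 0.
Proof.
rewrite /dpartial.
rewrite (_ : _ \o _ = (f \o par c.1) \o lsubmx) // partial_lsub.
by case: fintype.split => a //=; rewrite row_mxKl.
Qed.

Lemma dpartial_fibre (c : chart M) (i : 'I_(p + q)) (f : Mt -> R) (x : M) :
  dpartial c i (fun y : M => f y.2) x =
    if fintype.split i is inr a then dpartial c.2 a f x.2 else 0.
Proof.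
rewrite /dpartial.
rewrite (_ : _ \o _ = (f \o par c.2) \o rsubmx) // partial_rsub.
by case: fintype.split => a //=; rewrite row_mxKr.
Qed.

Lemma prod_jac (c d : chart M) (x : M) :
  jac c d x = block_mx (jac c.1 d.1 x.1) 0 0 (jac c.2 d.2 x.2).
Proof.
have locl (a : 'I_p) :
    (fun y : M => loc d y 0 (lshift q a)) = (fun y => loc d.1 y.1 0 a).
  by apply/funext => y; rewrite /loc /= row_mxEl.
have locr (a : 'I_q) :
    (fun y : M => loc d y 0 (rshift p a)) = (fun y => loc d.2 y.2 0 a).
  by apply/funext => y; rewrite /loc /= row_mxEr.
apply/matrixP => k i; rewrite mxE.
case: (split_ordP k) => a ->.
  rewrite locl (dpartial_base c i (fun y => loc d.1 y 0 a)).
  by case: split_ordP => b ->; rewrite ?block_mxEul ?block_mxEur !mxE.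
rewrite locr (dpartial_fibre c i (fun y => loc d.2 y 0 a)).
by case: split_ordP => b ->; rewrite ?block_mxEdl ?block_mxEdr !mxE.
Qed.

Fact prod_metric_sym c x : dom c x -> (gP c x)^T = gP c x.
Proof.
case: c x => c d [x y] [/= cx dy].
by rewrite /gP tr_block_mx !trmx0 !metric_sym.
Qed.

Lemma unitmx_diag_block (A : 'M[R]_p) (B : 'M[R]_q) :
  A \in unitmx -> B \in unitmx -> block_mx A 0 0 B \in unitmx.
Proof. by move=> uA uB; rewrite unitmxE det_ublock unitrM -!unitmxE uA. Qed.

Fact prod_metric_nondeg c x : dom c x -> gP c x \in unitmx.
Proof.
case: c x => c d [x y] [/= cx dy].
by apply: unitmx_diag_block; exact: metric_nondeg.
Qed.

Fact prod_metric_index :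
  exists nu, forall c x, dom c x -> has_index nu (gP c x).
Proof.
have [nu1 H1] := metric_index gb; have [nu2 H2] := metric_index gt.
exists (nu1 + nu2)%N => -[c d] [x y] [/= /H1 [P [s [uP gP1 <-]]]].
move=> /H2 [Q [t [uQ gQ2 <-]]].
pose st (i : 'I_(p + q)) :=
  match fintype.split i with inl a => s a | inr b => t b end.
have stl a : st (lshift q a) = s a by rewrite /st -/(unsplit (inl a)) unsplitK.
have str b : st (rshift p b) = t b by rewrite /st -/(unsplit (inr b)) unsplitK.
exists (block_mx P 0 0 Q), st; split.
- exact: unitmx_diag_block.
- rewrite /gP /= tr_block_mx !trmx0 !mulmx_block.
  rewrite !(mulmx0, mul0mx, addr0, add0r) gP1 gQ2 -diag_mx_row.
  congr diag_mx; apply/rowP => i; rewrite !mxE.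
  by case: (split_ordP i) => a ->; rewrite mxE ?stl ?str.
- rewrite -!sum1_card big_split_ord /=; congr (_ + _)%N.
    by apply: eq_bigl => a; rewrite -!topredE /= stl.
  by apply: eq_bigl => a; rewrite -!topredE /= str.
Qed.

Fact prod_metric_change c d x : dom c x -> dom d x ->
  gP c x = (jac c d x)^T *m gP d x *m jac c d x.
Proof.
case: c d x => c1 c2 [d1 d2] [x y] [/= cx cy] [/= dx dy].
rewrite prod_jac /gP /= tr_block_mx !trmx0 !mulmx_block.
rewrite !(mulmx0, mul0mx, addr0, add0r).
by rewrite -(metric_change gb cx dx) -(metric_change gt cy dy).
Qed.

Fact prod_metric_smooth c i j :
  smooth_on (loc c @` dom c) (fun u => gP c (par c u) i j).
Proof.
rewrite [X in smooth_on X _]prod_loc_image.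
case: (split_ordP i) => a ->; case: (split_ordP j) => b ->.
- rewrite (_ : (fun _ => _) = (fun u => gb c.1 (par c.1 u) a b) \o lsubmx).
    refine (smooth_sub _ (smooth_lsub (metric_smooth gb c.1 a b))).
    exact: subIsetl.
  by apply/funext => u; rewrite /gP block_mxEul.
- rewrite (_ : (fun _ => _) = cst 0); first exact: smooth_cst.
  by apply/funext => u; rewrite /gP block_mxEur mxE.
- rewrite (_ : (fun _ => _) = cst 0); first exact: smooth_cst.
  by apply/funext => u; rewrite /gP block_mxEdl mxE.
- rewrite (_ : (fun _ => _) = (fun u => gt c.2 (par c.2 u) a b) \o rsubmx).
    refine (smooth_sub _ (smooth_rsub (metric_smooth gt c.2 a b))).
    exact: subIsetr.
  by apply/funext => u; rewrite /gP block_mxEdr.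
Qed.

Definition prod_metric : metric M :=
  Metric prod_metric_sym prod_metric_nondeg prod_metric_index
    prod_metric_change prod_metric_smooth.

End ProductMetric.

(* A function of p (resp. q) coordinate indices, extended by 0 to the p + q
   coordinate indices of the product. *)
Definition base_index (R : realType) (p q : nat) (F : 'I_p -> R)
    (i : 'I_(p + q)) : R :=
  if fintype.split i is inl a then F a else 0.

Definition fibre_index (R : realType) (p q : nat) (F : 'I_q -> R)
    (i : 'I_(p + q)) : R :=
  if fintype.split i is inr a then F a else 0.

(* The components, in a product chart, of the two parts of a 1-form on the
   product, and of the pullbacks to the product of the tensors of the factors. *)
Section Parts.
Context {R : realType} {p q : nat} {Mb : manifold R p} {Mt : manifold R q}.
Let M := prod_manifold Mb Mt.
Implicit Types (c : chart M) (x : M).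

Definition base_form (Pi : one_form M) c x : 'I_(p + q) -> R :=
  base_index (fun a => Pi c x 0 (lshift q a)).

Definition fibre_form (Pi : one_form M) c x : 'I_(p + q) -> R :=
  fibre_index (fun a => Pi c x 0 (rshift p a)).

Definition base_riem (gb : metric Mb) c x (i j k l : 'I_(p + q)) : R :=
  base_index (fun i' => base_index (fun j' => base_index (fun k' =>
    base_index (fun l' => riem gb c.1 x.1 i' j' k' l') l) k) j) i.

Definition fibre_riem (gt : metric Mt) c x (i j k l : 'I_(p + q)) : R :=
  fibre_index (fun i' => fibre_index (fun j' => fibre_index (fun k' =>
    fibre_index (fun l' => riem gt c.2 x.2 i' j' k' l') l) k) j) i.

Definition base_ricci (gb : metric Mb) c x (j k : 'I_(p + q)) : R :=
  base_index (fun j' => base_index (fun k' => ricci gb c.1 x.1 j' k') k) j.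

Definition fibre_ricci (gt : metric Mt) c x (j k : 'I_(p + q)) : R :=
  fibre_index (fun j' => fibre_index (fun k' => ricci gt c.2 x.2 j' k') k) j.

Definition base_nabla_riem (gb : metric Mb) c x (m i j k l : 'I_(p + q)) : R :=
  base_index (fun m' => base_index (fun i' => base_index (fun j' =>
    base_index (fun k' => base_index (fun l' =>
      nabla_riem gb c.1 x.1 m' i' j' k' l') l) k) j) i) m.

Definition fibre_nabla_riem (gt : metric Mt) c x
    (m i j k l : 'I_(p + q)) : R :=
  fibre_index (fun m' => fibre_index (fun i' => fibre_index (fun j' =>
    fibre_index (fun k' => fibre_index (fun l' =>
      nabla_riem gt c.2 x.2 m' i' j' k' l') l) k) j) i) m.

End Parts.

(* Main.v *)
(* In a product chart the metric and its inverse are block diagonal and each block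
   depends on the coordinates of one factor only.  Hence the Christoffel symbols,
   R, S and nabla R have no mixed components, and their pure components are those
   of the factors.  Splitting the defining identity of a WGK_n by types of indices
   gives conditions 1 and 2; mixed components (i, l on one factor and j, k on the
   other) reduce to 2 Phi_m S_il S_jk = 0, that is, condition 3.  Conversely, the
   sum of the six identities over the appropriate indices is the defining one. *)
Require Import Defs.
From mathcomp Require Import all_boot all_order all_algebra.
From mathcomp Require Import all_classical all_reals all_analysis.
From mathcomp Require Import lra.

Set Implicit Arguments.
Unset Strict Implicit.
Unset Printing Implicit Defensive.

Import Order.TTheory GRing.Theory Num.Theory.
Import numFieldNormedType.Exports.

Local Open Scope classical_set_scope.
Local Open Scope ring_scope.

(** * Algebra of tensors without mixed components *)

Section BlockIndex.
Context {R : realType} {p q : nat}.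

Lemma base_index_lshift (F : 'I_p -> R) (a : 'I_p) :
  base_index F (lshift q a) = F a.
Proof. by rewrite /base_index -/(unsplit (inl a)) unsplitK. Qed.

Lemma base_index_rshift (F : 'I_p -> R) (b : 'I_q) :
  base_index F (rshift p b) = 0.
Proof. by rewrite /base_index -/(unsplit (inr b)) unsplitK. Qed.

Lemma fibre_index_lshift (F : 'I_q -> R) (a : 'I_p) :
  fibre_index F (lshift q a) = 0.
Proof. by rewrite /fibre_index -/(unsplit (inl a)) unsplitK. Qed.

Lemma fibre_index_rshift (F : 'I_q -> R) (b : 'I_q) :
  fibre_index F (rshift p b) = F b.
Proof. by rewrite /fibre_index -/(unsplit (inr b)) unsplitK. Qed.

Definition blockE := (base_index_lshift, base_index_rshift,
  fibre_index_lshift, fibre_index_rshift).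

Lemma invmx_diag_block (A : 'M[R]_p) (B : 'M[R]_q) :
  A \in unitmx -> B \in unitmx ->
  invmx (block_mx A 0 0 B) = block_mx (invmx A) 0 0 (invmx B).
Proof.
move=> uA uB; have uAB := unitmx_diag_block uA uB.
rewrite -[RHS]mul1mx -(mulVmx uAB) -mulmxA mulmx_block.
rewrite !(mulmx0, mul0mx, addr0, add0r) !mulmxV //.
by rewrite -scalar_mx_block mulmx1.
Qed.

Section Blocks.

(* [blockN F G] is the N-tensor on the product with pure components [F] on the
   base and [G] on the fibre, all mixed components being 0. *)
Definition block1 F G (i : 'I_(p + q)) : R := base_index F i + fibre_index G i.

Definition block2 F G (i j : 'I_(p + q)) : R :=
  base_index (fun a => base_index (F a) j) i
  + fibre_index (fun a => fibre_index (G a) j) i.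

Definition block3 F G (i j k : 'I_(p + q)) : R :=
  base_index (fun a => base_index (fun b => base_index (F a b) k) j) i
  + fibre_index (fun a => fibre_index (fun b => fibre_index (G a b) k) j) i.

Definition block4 F G (i j k l : 'I_(p + q)) : R :=
  base_index (fun a => base_index (fun b => base_index (fun d =>
    base_index (F a b d) l) k) j) i
  + fibre_index (fun a => fibre_index (fun b => fibre_index (fun d =>
    fibre_index (G a b d) l) k) j) i.

Definition block5 F G (m i j k l : 'I_(p + q)) : R :=
  base_index (fun e => base_index (fun a => base_index (fun b =>
    base_index (fun d => base_index (F e a b d) l) k) j) i) m
  + fibre_index (fun e => fibre_index (fun a => fibre_index (fun b =>
    fibre_index (fun d => fibre_index (G e a b d) l) k) j) i) m.

Let simp := (mulr0, mul0r, addr0, add0r, subr0, @oppr0 R, big1_eq).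

Lemma diag_block_mxE (A : 'M[R]_p) (B : 'M[R]_q) i j :
  block_mx A 0 0 B i j = block2 A B i j.
Proof.
rewrite /block2.
case: (split_ordP i) => a ->; case: (split_ordP j) => b ->; rewrite !blockE.
- by rewrite block_mxEul addr0.
- by rewrite block_mxEur mxE addr0.
- by rewrite block_mxEdl mxE add0r.
- by rewrite block_mxEdr add0r.
Qed.

(** [A], [B] stand for the inverse metrics of the factors, [D], [E] for the first derivatives of
    their metrics. The sum over [l] splits into a base half and a fibre half, and a half survives
    only if all free indices are of its type. The contraction lemmas below follow this pattern. *)
Lemma christoffel_block A B D E (k i j : 'I_(p + q)) :
  2^-1 * \sum_l block2 A B k l
    * (block3 D E i j l + block3 D E j i l - block3 D E l i j) =
  block3
    (fun k i j => 2^-1 * \sum_l A k l * (D i j l + D j i l - D l i j))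
    (fun k i j => 2^-1 * \sum_l B k l * (E i j l + E j i l - E l i j)) k i j.
Proof.
rewrite /block2 /block3 big_split_ord.
case: (split_ordP k) => a ->; case: (split_ordP i) => b ->;
  case: (split_ordP j) => d ->; rewrite !blockE;
  (* Every summand is now a pure term or 0; [big1_eq] clears a half made of zeros. *)
  under [X in _ * (X + _) = _]eq_bigr do rewrite !blockE !simp;
  under [X in _ * (_ + X) = _]eq_bigr do rewrite !blockE !simp;
  by rewrite !simp.
Qed.

Lemma nabla_vec_block D E A B V W (i m : 'I_(p + q)) :
  block2 D E i m + \sum_a block3 A B m i a * block1 V W a =
  block2 (fun i m => D i m + \sum_a A m i a * V a)
         (fun i m => E i m + \sum_a B m i a * W a) i m.
Proof.
rewrite /block1 /block2 /block3 big_split_ord.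
case: (split_ordP i) => b ->; case: (split_ordP m) => d ->; rewrite !blockE;
  under [X in _ + (X + _) = _]eq_bigr do rewrite !blockE !simp;
  under [X in _ + (_ + X) = _]eq_bigr do rewrite !blockE !simp;
  by rewrite !simp.
Qed.

(** [A j i k m] and [B j i k m] play the role of the [m]-th component of nabla_j nabla_i d_k on each
    factor, [D] and [E] that of the metrics. *)
Lemma riem_block A B D E (i j k l : 'I_(p + q)) :
  \sum_m (block4 A B j i k m - block4 A B i j k m) * block2 D E m l =
  block4 (fun i j k l => \sum_m (A j i k m - A i j k m) * D m l)
         (fun i j k l => \sum_m (B j i k m - B i j k m) * E m l) i j k l.
Proof.
rewrite /block2 /block4 big_split_ord.
case: (split_ordP k) => k' ->; case: (split_ordP i) => i' ->;
  case: (split_ordP j) => j' ->; case: (split_ordP l) => l' ->;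
  rewrite !blockE;
  under [X in X + _ = _]eq_bigr do rewrite !blockE !simp;
  under [X in _ + X = _]eq_bigr do rewrite !blockE !simp;
  by rewrite !simp.
Qed.

Lemma ricci_block A B D E (j k : 'I_(p + q)) :
  \sum_i \sum_l block2 A B i l * block4 D E i j k l =
  block2 (fun j k => \sum_i \sum_l A i l * D i j k l)
         (fun j k => \sum_i \sum_l B i l * E i j k l) j k.
Proof.
(* One contraction at a time: while [i] is free, the sum over [l] is itself a block tensor, so the
   sum over [i] can be split in the same way. *)
have inner (i : 'I_(p + q)) : \sum_l block2 A B i l * block4 D E i j k l =
    block3 (fun i j k => \sum_l A i l * D i j k l)
           (fun i j k => \sum_l B i l * E i j k l) i j k.
  rewrite /block2 /block3 /block4 big_split_ord.
  case: (split_ordP i) => i' ->; case: (split_ordP j) => j' ->;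
    case: (split_ordP k) => k' ->; rewrite !blockE;
    under [X in X + _ = _]eq_bigr do rewrite !blockE !simp;
    under [X in _ + X = _]eq_bigr do rewrite !blockE !simp;
    by rewrite !simp.
under eq_bigr do rewrite inner.
rewrite /block2 /block3 big_split_ord.
case: (split_ordP j) => j' ->; case: (split_ordP k) => k' ->; rewrite !blockE;
  under [X in X + _ = _]eq_bigr do rewrite !blockE !simp;
  under [X in _ + X = _]eq_bigr do rewrite !blockE !simp;
  by rewrite !simp.
Qed.

(** In each correction term the Christoffel factor forces [a] and the replaced index to have the
    type of [m]; the curvature factor then forces this type on the other three indices. *)
Lemma nabla_riem_block A B D E F G (m i j k l : 'I_(p + q)) :
  block5 A B m i j k l
  - \sum_a (block3 D E a m i * block4 F G a j k l
            + block3 D E a m j * block4 F G i a k l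
            + block3 D E a m k * block4 F G i j a l
            + block3 D E a m l * block4 F G i j k a) =
  block5
    (fun m i j k l => A m i j k l
      - \sum_a (D a m i * F a j k l + D a m j * F i a k l
                + D a m k * F i j a l + D a m l * F i j k a))
    (fun m i j k l => B m i j k l
      - \sum_a (E a m i * G a j k l + E a m j * G i a k l
                + E a m k * G i j a l + E a m l * G i j k a)) m i j k l.
Proof.
rewrite /block3 /block4 /block5 big_split_ord.
case: (split_ordP k) => k' ->; case: (split_ordP i) => i' ->;
  case: (split_ordP j) => j' ->; case: (split_ordP l) => l' ->;
  case: (split_ordP m) => m' ->; rewrite !blockE;
  under [X in _ - (X + _) = _]eq_bigr do rewrite !blockE !simp;
  under [X in _ - (_ + X) = _]eq_bigr do rewrite !blockE !simp;
  by rewrite !simp.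
Qed.

End Blocks.

End BlockIndex.

(** * Derivatives in a chart *)

Section Charts.
Context {R : realType} {n : nat} {M : manifold R n}.

(* Outside [dom c] the values of geometric quantities are junk, so only equality
   on the open set [dom c] is available, and it suffices for derivatives. *)
Lemma dpartial_ext (c : chart M) i (f h : M -> R) x : dom c x ->
  (forall y, dom c y -> f y = h y) -> dpartial c i f x = dpartial c i h x.
Proof.
move=> cx fh; apply: near_eq_derive.
have : nbhs (loc c x) (loc c @` dom c).
  by apply: open_nbhs_nbhs; split; [exact: loc_open | exists x].
by apply: filterS => _ [y cy <-] /=; rewrite locK // fh.
Qed.

Lemma dpartial_cst (c : chart M) i (a : R) x : dpartial c i (fun=> a) x = 0.
Proof.
by rewrite /dpartial (_ : _ \o _ = cst a) // partial_cst.
Qed.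

(** A field lifted from one factor has the zero field as its part on the other; this disposes of
    that part. *)
Lemma nabla_vec0 (g : metric M) (c : chart M) i m x :
  nabla_vec g c i (fun _ _ => 0) m x = 0.
Proof.
by rewrite /nabla_vec dpartial_cst add0r big1 // => a _; rewrite mulr0.
Qed.

End Charts.

(** * Connection and curvature of the product metric *)

Section ProductCurvature.
Context {R : realType} {p q : nat} {Mb : manifold R p} {Mt : manifold R q}.
Variables (gb : metric Mb) (gt : metric Mt).
Let M := prod_manifold Mb Mt.
Let g := prod_metric gb gt.
Implicit Types (c : chart M) (x y : M).

Let simp := (mulr0, mul0r, addr0, add0r).

Lemma dpartial_base_ext c i (h : M -> R) (f : Mb -> R) x :
  dom c x -> (forall y, dom c y -> h y = f y.1) ->
  dpartial c i h x = base_index (fun a => dpartial c.1 a f x.1) i.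
Proof. by move=> cx hf; rewrite (dpartial_ext _ cx hf) dpartial_base. Qed.

Lemma dpartial_fibre_ext c i (h : M -> R) (f : Mt -> R) x :
  dom c x -> (forall y, dom c y -> h y = f y.2) ->
  dpartial c i h x = fibre_index (fun a => dpartial c.2 a f x.2) i.
Proof. by move=> cx hf; rewrite (dpartial_ext _ cx hf) dpartial_fibre. Qed.

Lemma dpartial0_ext c i (h : M -> R) x :
  dom c x -> (forall y, dom c y -> h y = 0) -> dpartial c i h x = 0.
Proof. by move=> cx h0; rewrite (dpartial_ext _ cx h0) dpartial_cst. Qed.

(** The type of [j] decides on which factor alone [h] depends, so derivatives along the other factor
    vanish. *)
Lemma dpartial_block1 c i j (h : M -> R)
    (F : 'I_p -> Mb -> R) (G : 'I_q -> Mt -> R) x : dom c x ->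
  (forall y, dom c y -> h y = block1 (F^~ y.1) (G^~ y.2) j) ->
  dpartial c i h x =
    block2 (fun i j => dpartial c.1 i (F j) x.1)
           (fun i j => dpartial c.2 i (G j) x.2) i j.
Proof.
rewrite /block1 /block2; case: (split_ordP j) => a -> cx hFG;
  (* Typing selects the alternative: [F a] is ill-typed when [a] is a fibre index. *)
  first [rewrite (@dpartial_base_ext _ _ _ (F a)) //
        |rewrite (@dpartial_fibre_ext _ _ _ (G a)) //];
  try (by move=> y cy; rewrite hFG // !blockE !simp);
  by case: (split_ordP i) => e ->; rewrite !blockE !simp.
Qed.

Lemma dpartial_block2 c i j k (h : M -> R)
    (F : 'I_p -> 'I_p -> Mb -> R) (G : 'I_q -> 'I_q -> Mt -> R) x : dom c x ->
  (forall y, dom c y ->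
    h y = block2 (fun a b => F a b y.1) (fun a b => G a b y.2) j k) ->
  dpartial c i h x =
    block3 (fun i j k => dpartial c.1 i (F j k) x.1)
           (fun i j k => dpartial c.2 i (G j k) x.2) i j k.
Proof.
rewrite /block2 /block3; case: (split_ordP j) => a ->;
  case: (split_ordP k) => b -> cx hFG;
  (* A mixed pair fits neither [F] nor [G]; there [h] is 0 on the whole chart domain. *)
  first [rewrite (@dpartial_base_ext _ _ _ (F a b)) //
        |rewrite (@dpartial_fibre_ext _ _ _ (G a b)) //
        |rewrite dpartial0_ext //];
  try (by move=> y cy; rewrite hFG // !blockE !simp);
  by case: (split_ordP i) => e ->; rewrite !blockE !simp.
Qed.

Lemma dpartial_block4 c m i j k l (h : M -> R)
    (F : 'I_p -> 'I_p -> 'I_p -> 'I_p -> Mb -> R)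
    (G : 'I_q -> 'I_q -> 'I_q -> 'I_q -> Mt -> R) x : dom c x ->
  (forall y, dom c y -> h y = block4 (fun a b d e => F a b d e y.1)
                                     (fun a b d e => G a b d e y.2) i j k l) ->
  dpartial c m h x =
    block5 (fun m i j k l => dpartial c.1 m (F i j k l) x.1)
           (fun m i j k l => dpartial c.2 m (G i j k l) x.2) m i j k l.
Proof.
rewrite /block4 /block5; case: (split_ordP i) => a ->;
  case: (split_ordP j) => b ->; case: (split_ordP k) => d ->;
  case: (split_ordP l) => e -> cx hFG;
  first [rewrite (@dpartial_base_ext _ _ _ (F a b d e)) //
        |rewrite (@dpartial_fibre_ext _ _ _ (G a b d e)) //
        |rewrite dpartial0_ext //];
  try (by move=> y cy; rewrite hFG // !blockE !simp);
  by case: (split_ordP m) => m' ->; rewrite !blockE !simp.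
Qed.

Lemma prod_metricE c x i j :
  g c x i j = block2 (gb c.1 x.1) (gt c.2 x.2) i j.
Proof. exact: diag_block_mxE. Qed.

Lemma prod_invmx_metricE c x i j : dom c x ->
  invmx (g c x) i j = block2 (invmx (gb c.1 x.1)) (invmx (gt c.2 x.2)) i j.
Proof.
by case=> cx cy; rewrite invmx_diag_block ?metric_nondeg // diag_block_mxE.
Qed.

Lemma christoffel_prod c k i j x : dom c x ->
  christoffel g c k i j x =
    block3 (fun k i j => christoffel gb c.1 k i j x.1)
           (fun k i j => christoffel gt c.2 k i j x.2) k i j.
Proof.
move=> cx; rewrite -christoffel_block; congr (_ * _).
have dg i' j' l := @dpartial_block2 c i' j' l _ (fun a b z => gb c.1 z a b)
  (fun a b z => gt c.2 z a b) x cx (fun y _ => prod_metricE c y j' l).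
by apply: eq_bigr => l _; rewrite prod_invmx_metricE // !dg.
Qed.

(** On the chart domain [V] is the sum of the lifts of [W] and [Z]. Such fields are differentiated
    factor by factor, since neither their partial derivatives nor the Christoffel symbols have mixed
    components. *)
Lemma nabla_vec_prod c i (V : 'I_(p + q) -> M -> R) (W : 'I_p -> Mb -> R)
    (Z : 'I_q -> Mt -> R) m x : dom c x ->
  (forall k y, dom c y -> V k y = block1 (W^~ y.1) (Z^~ y.2) k) ->
  nabla_vec g c i V m x =
    block2 (fun i m => nabla_vec gb c.1 i W m x.1)
           (fun i m => nabla_vec gt c.2 i Z m x.2) i m.
Proof.
move=> cx VWZ; rewrite -nabla_vec_block /nabla_vec.
rewrite (dpartial_block1 i cx (VWZ m)); congr (_ + _).
by apply: eq_bigr => a _; rewrite christoffel_prod // VWZ.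
Qed.

Lemma nabla_coord_prod c i k m x : dom c x ->
  nabla_vec g c i (coord_field k) m x =
    block3 (fun i k m => nabla_vec gb c.1 i (coord_field k) m x.1)
           (fun i k m => nabla_vec gt c.2 i (coord_field k) m x.2) i k m.
Proof.
move=> cx; case: (split_ordP k) => a ->.
  (* A base coordinate field lifts its base counterpart and has zero fibre part. *)
  rewrite (@nabla_vec_prod _ _ _ (coord_field a) (fun _ _ => 0)) //.
    rewrite /block2 /block3.
    by case: (split_ordP i) => b ->; case: (split_ordP m) => d ->;
      rewrite !blockE ?nabla_vec0.
  move=> k' y _; rewrite /coord_field /block1.
  case: (split_ordP k') => b ->; rewrite !blockE !simp.
    by rewrite (inj_eq (@lshift_inj _ _)).
  by rewrite eq_rlshift.
rewrite (@nabla_vec_prod _ _ _ (fun _ _ => 0) (coord_field a)) //.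
  rewrite /block2 /block3.
  by case: (split_ordP i) => b ->; case: (split_ordP m) => d ->;
    rewrite !blockE ?nabla_vec0.
move=> k' y _; rewrite /coord_field /block1.
case: (split_ordP k') => b ->; rewrite !blockE !simp.
  by rewrite eq_lrshift.
by rewrite (inj_eq (@rshift_inj _ _)).
Qed.

Lemma nabla2_coord_prod c i j k m x : dom c x ->
  nabla_vec g c j (nabla_vec g c i (coord_field k)) m x =
    block4
      (fun j i k m =>
        nabla_vec gb c.1 j (nabla_vec gb c.1 i (coord_field k)) m x.1)
      (fun j i k m =>
        nabla_vec gt c.2 j (nabla_vec gt c.2 i (coord_field k)) m x.2) j i k m.
Proof.
(* The outer derivative needs the inner field on the whole chart domain, not only at [x]. *)
move=> cx; have N m' y (cy : dom c y) := nabla_coord_prod i k m' cy.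
rewrite /block4; case: (split_ordP i) N => a ->; case: (split_ordP k) => b -> N;
  (* The inner field is lifted from the base or from the fibre when [i] and [k] agree in type, and
     is zero otherwise. *)
  first [rewrite (@nabla_vec_prod _ _ _ (nabla_vec gb c.1 a (coord_field b))
           (fun _ _ => 0)) //
        |rewrite (@nabla_vec_prod _ _ _ (fun _ _ => 0)
           (nabla_vec gt c.2 a (coord_field b))) //
        |rewrite (@nabla_vec_prod _ _ _ (fun _ _ => 0) (fun _ _ => 0)) //];
  try (by move=> m' y cy; rewrite N // /block1 /block3;
    case: (split_ordP m') => e ->; rewrite !blockE);
  by rewrite /block2; case: (split_ordP j) => d ->; case: (split_ordP m) => e ->;
    rewrite !blockE ?nabla_vec0.
Qed.

Lemma riem_prod c x i j k l : dom c x ->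
  riem g c x i j k l =
    block4 (riem gb c.1 x.1) (riem gt c.2 x.2) i j k l.
Proof.
move=> cx; rewrite -riem_block; apply: eq_bigr => m _.
by rewrite !nabla2_coord_prod // prod_metricE.
Qed.

Lemma ricci_prod c x j k : dom c x ->
  ricci g c x j k = block2 (ricci gb c.1 x.1) (ricci gt c.2 x.2) j k.
Proof.
move=> cx; rewrite -ricci_block; do 2!apply: eq_bigr => ? _.
by rewrite prod_invmx_metricE // riem_prod.
Qed.

Lemma nabla_riem_prod c x m i j k l : dom c x ->
  nabla_riem g c x m i j k l =
    block5 (nabla_riem gb c.1 x.1) (nabla_riem gt c.2 x.2) m i j k l.
Proof.
move=> cx; rewrite -nabla_riem_block; congr (_ - _).
  apply: (@dpartial_block4 _ _ _ _ _ _ _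
    (fun i j k l z => riem gb c.1 z i j k l)
    (fun i j k l z => riem gt c.2 z i j k l)) => // y cy.
  exact: riem_prod.
by apply: eq_bigr => a _; rewrite !christoffel_prod // !riem_prod.
Qed.

End ProductCurvature.

(** * Splitting the recurrence identity by index types *)

Theorem corollary4p12 (R : realType) (p q : nat)
  (hp : (1 <= p)%N) (hq : (1 <= q)%N) (hn : (3 <= p + q)%N)
  (Mb : manifold R p) (Mt : manifold R q) (gb : metric Mb) (gt : metric Mt)
  (hflat : ~ flat (prod_metric gb gt))
  (Pi Phi : one_form (prod_manifold Mb Mt)) :
  WGK (prod_metric gb gt) Pi Phi <->
  forall x, nonrecurrent_set (prod_metric gb gt) x ->
  forall c, dom c x ->
  [/\ (forall m i j k l,
         base_nabla_riem gb c x m i j k l =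
           base_form Pi c x m * base_riem gb c x i j k l
           + base_form Phi c x m
             * KN (base_ricci gb c x) (base_ricci gb c x) i j k l)
      /\ (forall m i j k l,
         fibre_form Pi c x m * base_riem gb c x i j k l
         + fibre_form Phi c x m
           * KN (base_ricci gb c x) (base_ricci gb c x) i j k l = 0),
      (forall m i j k l,
         base_form Pi c x m * fibre_riem gt c x i j k l
         + base_form Phi c x m
           * KN (fibre_ricci gt c x) (fibre_ricci gt c x) i j k l = 0)
      /\ (forall m i j k l,
         fibre_nabla_riem gt c x m i j k l =
           fibre_form Pi c x m * fibre_riem gt c x i j k l
           + fibre_form Phi c x m
             * KN (fibre_ricci gt c x) (fibre_ricci gt c x) i j k l)
    & (forall m i j k l,
         base_form Phi c x m * base_ricci gb c x i j * fibre_ricci gt c x k l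
         = 0)
      /\ (forall m i j k l,
         fibre_form Phi c x m * base_ricci gb c x i j * fibre_ricci gt c x k l
         = 0)].
Proof.
have formE (F : one_form (prod_manifold Mb Mt)) c x m :
    F c x 0 m = base_form F c x m + fibre_form F c x m.
  by rewrite /base_form /fibre_form; case: (split_ordP m) => a ->;
    rewrite !blockE ?addr0 ?add0r.
split=> H x Ux c cx; last first.
  move=> m i j k l.
  have [[H1 H1'] [H2 H2'] [H3 H3']] := H x Ux c cx.
  rewrite nabla_riem_prod // riem_prod // !formE /KN !ricci_prod //.
  have nablaE : block5 (nabla_riem gb c.1 x.1) (nabla_riem gt c.2 x.2) m i j k l =
    base_nabla_riem gb c x m i j k l + fibre_nabla_riem gt c x m i j k l by [].
  have riemE : block4 (riem gb c.1 x.1) (riem gt c.2 x.2) i j k l =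
    base_riem gb c x i j k l + fibre_riem gt c x i j k l by [].
  have ricE a b : block2 (ricci gb c.1 x.1) (ricci gt c.2 x.2) a b =
    base_ricci gb c x a b + fibre_ricci gt c x a b by [].
  rewrite nablaE riemE !ricE H1 H2'.
  (* Besides the two vanishing conditions, the eight instances of condition 3 are the cross terms of
     base and fibre Ricci tensors in the expanded Kulkarni-Nomizu square, four for each part of
     [Phi]. *)
  move: (H1' m i j k l) (H2 m i j k l) (H3 m i l j k) (H3 m j k i l)
    (H3 m i k j l) (H3 m j l i k) (H3' m i l j k) (H3' m j k i l)
    (H3' m i k j l) (H3' m j l i k).
  rewrite /KN.
  move=> E1 E2 E3 E4 E5 E6 E7 E8 E9 E10.
  lra.
have {}H m i j k l : block5 (nabla_riem gb c.1 x.1) (nabla_riem gt c.2 x.2) m i j k l =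
    Pi c x 0 m * block4 (riem gb c.1 x.1) (riem gt c.2 x.2) i j k l
    + Phi c x 0 m *
      KN (block2 (ricci gb c.1 x.1) (ricci gt c.2 x.2))
         (block2 (ricci gb c.1 x.1) (ricci gt c.2 x.2)) i j k l.
  rewrite -nabla_riem_prod // -riem_prod // H //.
  by rewrite /KN !ricci_prod.
rewrite /base_nabla_riem /fibre_nabla_riem /base_riem /fibre_riem.
rewrite /KN /base_ricci /fibre_ricci /base_form /fibre_form.
move: H; rewrite /KN /block2 /block4 /block5.
(* What remains is pure index algebra, valid for arbitrary components. *)
move: (nabla_riem gb _ _) (nabla_riem gt _ _) (riem gb _ _) (riem gt _ _)
  (ricci gb _ _) (ricci gt _ _) => A B C D S T.
move: (Pi c x) (Phi c x) => P F H.
have simp := (mulr0, mul0r, addr0, add0r, subr0, oppr0).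
split; split=> m i j k l.
1-4: move: (H m i j k l).
(* In this order the first product of the Kulkarni-Nomizu square pairs [i] with [j] and [k] with
   [l]. For [i], [j] on the base and [k], [l] on the fibre, nabla R and R vanish, and twice the
   wanted product equals 0. *)
5-6: move: (H m i k l j).
all: case: (split_ordP m) => m' ->; case: (split_ordP i) => i' ->.
all: case: (split_ordP j) => j' ->; case: (split_ordP k) => k' ->.
all: case: (split_ordP l) => l' ->; rewrite !blockE ?simp => E //.
all: clear -E; lra.
Qed.
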